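(* Let $\Omega\subset\mathbb{R}^p$ be a compact set, let $\mathcal{L}:\Omega\to\mathbb{R}$ be $C^1$, and let $\theta_0\sim p_0$ be a random variable with values in $\Omega$ (the initialized network parameters). Let $(\theta_t)_{t\ge 0}$ be the (random) gradient descent curve started at $\theta_0$, i.e. $\dot\theta_t=-\nabla\mathcal{L}(\theta_t)$, and suppose that it stays in $\Omega$. Define $p_t=\mathrm{Law}(\theta_t)$ and assume further that $p_t>0$ almost everywhere. Then $(p_t)_{t\ge0}$ satisfies the continuity equation $$\partial_t p_t-\nabla\cdot(p_t\nabla\mathcal{L})=0 .$$
   Context: The gradient descent curve is the continuous-time (learning rate to zero) limit of $\theta_{k+1}=\theta_k-\alpha\nabla\mathcal{L}(\theta_k)$, i.e. the gradient flow of the loss $\mathcal{L}$; the dynamics are deterministic and the only randomness is in the initialization $\theta_0\sim p_0$. ''$p_t>0$ a.e.'' means that $p_t$ has a density with respect to Lebesgue measure on $\Omega$ that is positive almost everywhere. The continuity equation is understood in the sense of distributions, i.e. $\int_0^\infty\int_\Omega\big(\partial_t\varphi(t,x)-\nabla\varphi(t,x)\cdot\nabla\mathcal{L}(x)\big)\,dp_t(x)\,dt=0$ for all $C^1$ test functions $\varphi$ with compact support in $(0,\infty)\times\mathbb{R}^p$. *)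

(* Defs.v *)
From HB Require Import structures.
From mathcomp Require Import all_boot all_order all_algebra.
From mathcomp Require Import all_classical all_reals all_analysis.
From mathcomp Require Import measurable_realfun.

Set Implicit Arguments.
Unset Strict Implicit.
Unset Printing Implicit Defensive.

Import Order.TTheory GRing.Theory Num.Theory.
Import numFieldNormedType.Exports.

Local Open Scope classical_set_scope.
Local Open Scope ring_scope.

(* R^p is ['rV[R]_p], with the Borel sigma-algebra of its norm topology. *)

HB.instance Definition _ (R : realType) (m n : nat) :=
  @isMeasurable.Build (sigma_display (@open 'M[R]_(m, n))) 'M[R]_(m, n)
    <<s @open 'M[R]_(m, n) >>
    (@sigma_algebra0 _ setT _) (@sigma_algebraC _ _)
    (@sigma_algebra_bigcup _ setT _).

Section lebesgue_rV.
Variable R : realType.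

Definition consr (n : nat) (z : R * 'rV[R]_n) : 'rV[R]_n.+1 :=
  row_mx z.1%:M z.2.

(* The n-fold product of the one-dimensional Lebesgue measure, transported
   along the identification of R * R^n with R^(n+1). *)
Fixpoint lebesgue_rV (n : nat) : set 'rV[R]_n -> \bar R :=
  match n with
  | 0 => \d_(0 : 'rV[R]_0)
  | n'.+1 => pushforward (lebesgue_measure \x lebesgue_rV (n := n'))%E
               (@consr n')
  end.

Lemma consr0 n (z : R * 'rV[R]_n) : consr z 0 0 = z.1.
Proof.
have -> : (0 : 'I_n.+1) = lshift n (0 : 'I_1) by apply/val_inj.
by apply: etrans (row_mxEl _ _ _ _) _; rewrite mxE eqxx mulr1n.
Qed.

Lemma consrS n (z : R * 'rV[R]_n) j : consr z 0 (lift 0 j) = z.2 0 j.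
Proof.
have -> : lift 0 j = rshift 1 j by apply/val_inj.
exact: row_mxEr.
Qed.

Lemma ball_rVE n (x y : 'rV[R]_n) (e : R) :
  ball x e y <-> 0 < e /\ forall j, ball (x 0 j) e (y 0 j).
Proof.
by split=> -[e0 xy]; split=> // i j; rewrite !ord1; exact: xy.
Qed.

Lemma consr_ball n (z : R * 'rV[R]_n) (e : R) :
  @consr n @^-1` ball (consr z) e = ball z.1 e `*` ball z.2 e.
Proof.
apply/seteqP; split=> w /=.
  move=> /ball_rVE[e0 zw]; split.
    by have := zw 0; rewrite !consr0.
  by apply/ball_rVE; split=> // j; have := zw (lift 0 j); rewrite !consrS.
move=> [zw1 /ball_rVE[e0 zw2]]; apply/ball_rVE; split=> // j.
have [k ->|->] := unliftP 0 j; first by rewrite !consrS.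
by rewrite !consr0.
Qed.

Lemma rV_ratr_dense n (y : 'rV[R]_n) (e : R) : 0 < e ->
  exists q : 'rV[rat]_n, ball (map_mx ratr q : 'rV[R]_n) e y.
Proof.
move=> e0.
have /choice[f fP] : forall j, exists q : rat, ball (ratr q : R) e (y 0 j).
  move=> j; have /rat_in_itvoo[q] : y 0 j - e < y 0 j + e.
    by rewrite ltrBlDr -addrA ltrDl addr_gt0.
  rewrite in_itv/= => /andP[h1 h2]; exists q; apply: ball_sym.
  by rewrite /ball/= ltr_distlC h1.
by exists (\row_j f j); apply/ball_rVE; split=> // j; rewrite !mxE.
Qed.

Lemma open_rV_measurable n (A : set 'rV[R]_n) : open A -> measurable A.
Proof. by move=> oA; apply: sub_sigma_algebra. Qed.

Lemma open_prod_measurable n (A : set (R * 'rV[R]_n)) :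
  open A -> measurable A.
Proof.
move=> oA.
pose B (i : rat * 'rV[rat]_n * nat) : set (R * 'rV[R]_n) :=
  ball (ratr i.1.1 : R) i.2.+1%:R^-1 `*`
  ball (map_mx ratr i.1.2 : 'rV[R]_n) i.2.+1%:R^-1.
have -> : A = \bigcup_(i in [set i | B i `<=` A]) B i.
  apply/seteqP; split=> [[x y] Axy|z [i /= BA /BA//]].
  have /nbhs_ballP[e /= e0 eA] : nbhs (x, y) A by exact: open_nbhs_nbhs.
  have [k ke] : exists k, k.+1%:R^-1 < e / 2.
    have := @near_infty_natSinv_lt R (PosNum (divr_gt0 e0 (ltr0n _ 2))).
    by case=> k _ kP; exists k; apply: (kP k) => /=.
  have k0 : 0 < k.+1%:R^-1 :> R by rewrite invr_gt0.
  have [q1 q1P] : exists q : rat, ball (ratr q : R) k.+1%:R^-1 x.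
    have [q /ball_rVE[_ /(_ 0)]] := rV_ratr_dense (const_mx x : 'rV_1) k0.
    by rewrite !mxE; exists (q 0 0).
  have [q2 q2P] := rV_ratr_dense y k0.
  exists ((q1, q2), k) => //= -[u v] [/= uP vP]; apply: eA.
  split=> /=; (apply: (@le_ball _ _ _ (k.+1%:R^-1 + k.+1%:R^-1));
    first by rewrite [leRHS]splitr lerD// ltW).
    by apply: ball_triangle uP; exact: ball_sym.
  by apply: ball_triangle vP; exact: ball_sym.
rewrite bigcup_mkcond; apply: countable_bigcupT_measurable => //= i.
case: ifP => // _; apply: measurableX; first exact: measurable_ball.
by apply: open_rV_measurable; exact: ball_open.
Qed.

Lemma consr_measurable n : measurable_fun setT (@consr n).
Proof.
apply: (@measurability _ _ _ _ _ _ (@open 'rV[R]_n.+1)) => //.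
move=> _ [A oA <-].
rewrite setTI; apply: open_prod_measurable.
rewrite openE => z Az; apply/nbhs_ballP.
have /nbhs_ballP[e /= e0 eA] : nbhs (consr z) A by exact: open_nbhs_nbhs.
exists e => // w zw; apply: eA.
by have /seteqP[_] := consr_ball z e; apply.
Qed.

Let lebesgue_rVP n : exists2 m : {sigma_finite_measure set 'rV[R]_n -> \bar R},
  lebesgue_rV (n := n) = m & forall r : R, (m (ball 0%R r) < +oo)%E.
Proof.
elim: n => [|n [m mE moo]].
  exists (\d_(0 : 'rV[R]_0)) => // r.
  by rewrite /= diracE; case: (_ \in _); rewrite ltry.
pose mu := measure_function_pushforward__canonical__measure_function_Measure
  (lebesgue_measure \x m)%E (@consr_measurable n).
have muoo (r : R) : (mu (ball 0%R r) < +oo)%E.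
  have z0 : @consr n (0, 0) = 0.
    by rewrite /consr /= raddf0 row_mx0.
  rewrite /mu/= /pushforward/= -z0 consr_ball product_measure1E//=.
  - have [r0|r0] := leP 0 r.
      rewrite lebesgue_measure_ball// lte_mul_pinfty// ?fin_numE//.
      by rewrite lee_fin mulrn_wge0.
    by rewrite ((ball0 _ _).2 (ltW r0)) measure0 mul0e ltry.
  - exact: measurable_ball.
  - by apply: open_rV_measurable; exact: ball_open.
have mus : sigma_finite setT mu.
  exists (fun k => ball 0%R k%:R) => [|k]; last first.
    by split => //; apply: open_rV_measurable; exact: ball_open.
  apply/seteqP; split=> // x _; exists (Num.truncn `|x|).+1 => //.
  by rewrite -ball_normE /= sub0r normrN truncnS_gt.
pose muM := Measure_isSigmaFinite.Build _ _ _ (mu : set _ -> \bar R) mus.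
pose mu' : {sigma_finite_measure set 'rV[R]_n.+1 -> \bar R} :=
  HB.pack (mu : set _ -> \bar R) (Measure.class mu) muM.
by exists mu'; rewrite //= mE.
Qed.

Let lebesgue_rV0 n : lebesgue_rV (n := n) set0 = 0%E.
Proof. by have [m -> _] := lebesgue_rVP n; exact: measure0. Qed.

Let lebesgue_rV_ge0 n A : (0 <= lebesgue_rV (n := n) A)%E.
Proof. by have [m -> _] := lebesgue_rVP n; exact: measure_ge0. Qed.

Let lebesgue_rV_semi_sigma_additive n :
  semi_sigma_additive (lebesgue_rV (n := n)).
Proof.
by have [m -> _] := lebesgue_rVP n; exact: measure_semi_sigma_additive.
Qed.

HB.instance Definition _ n := isMeasure.Build _ _ _ (lebesgue_rV (n := n))
  (lebesgue_rV0 n) (@lebesgue_rV_ge0 n) (@lebesgue_rV_semi_sigma_additive n).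

Let lebesgue_rV_sigma_finite n : sigma_finite setT (lebesgue_rV (n := n)).
Proof. by have [m -> _] := lebesgue_rVP n; exact: sigma_finiteT. Qed.

HB.instance Definition _ n := Measure_isSigmaFinite.Build _ _ _
  (lebesgue_rV (n := n)) (@lebesgue_rV_sigma_finite n).

End lebesgue_rV.

(* For open U in a finite-dimensional space this is continuity of the
   differential on U. *)
Definition C1_on (R : realType) (V : normedModType R) (U : set V)
    (f : V -> R) : Prop :=
  forall x, U x ->
    differentiable f x /\ forall v : V, {for x, continuous (fun y => 'D_v f y)}.

(* C^1 on a set K that need not be open: C^1 on an open neighbourhood of K,
   the values of f outside this neighbourhood being irrelevant. *)
Definition C1_near (R : realType) (V : normedModType R) (K : set V)
    (f : V -> R) : Prop :=
  exists U : set V, [/\ open U, K `<=` U & C1_on U f].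

Definition grad (R : realType) (p : nat) (f : 'rV[R]_p -> R)
    (x : 'rV[R]_p) : 'rV[R]_p :=
  \row_i 'D_(delta_mx 0 i) f x.

(* The limit is taken along s >= 0, so that the derivative is two-sided at
   t > 0 and one-sided at t = 0. *)
Definition gradient_flow (R : realType) (p : nat) (L : 'rV[R]_p -> R)
    (c : R -> 'rV[R]_p) : Prop :=
  forall t : R, 0 <= t ->
    (s - t)^-1 *: (c s - c t) @[s --> within `[0, +oo[ t^'] --> - grad L (c t).

Definition ae_positive_density (R : realType) (p : nat) (K : set 'rV[R]_p)
    (mu : set 'rV[R]_p -> \bar R) : Prop :=
  exists f : 'rV[R]_p -> R,
    [/\ measurable_fun K f,
        {ae @lebesgue_rV R p, forall x, K x -> 0 < f x} &
        forall A, measurable A ->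
          mu A = (\int[@lebesgue_rV R p]_(x in A `&` K) (f x)%:E)%E].

Definition test_function (R : realType) (p : nat)
    (phi : R * 'rV[R]_p -> R) : Prop :=
  let supp := closure [set z | phi z != 0] in
  [/\ C1_on setT phi, compact supp & supp `<=` [set z | 0 < z.1]].

(* d_t phi - grad phi . grad L at (t, x), where grad acts on the space
   variable. *)
Definition weak_integrand (R : realType) (p : nat) (L : 'rV[R]_p -> R)
    (phi : R * 'rV[R]_p -> R) (t : R) (x : 'rV[R]_p) : R :=
  'D_1 (fun s : R => phi (s, x)) t -
  \sum_(i < p) grad (fun y => phi (t, y)) x 0 i * grad L x 0 i.

(* d_t mu - div (mu grad L) = 0 on (0, +oo) x R^p in the sense of
   distributions, for a curve mu of measures carried by K; a test function on
   (0, +oo) x R^p is identified with its extension by zero. *)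
Definition continuity_equation (R : realType) (p : nat) (K : set 'rV[R]_p)
    (L : 'rV[R]_p -> R) (mu : R -> set 'rV[R]_p -> \bar R) : Prop :=
  forall phi : R * 'rV[R]_p -> R, test_function phi ->
    (\int[lebesgue_measure]_(t in `]0%R, +oo[)
       \int[mu t]_(x in K) (weak_integrand L phi t x)%:E = 0)%E.

(* Main.v *)
(* Along each curve, the chain rule gives
   d/dt phi(t, theta_t) = (d_t phi - grad phi . grad L)(t, theta_t).
   This is bounded uniformly over compact time intervals because Omega is
   compact, so F(t) = E[phi(t, theta_t)] may be differentiated under the
   expectation: F is C^1 on (0, +oo), and F'(t) is the inner integral of the
   continuity equation by transport of measure. As phi has compact support in
   time, F vanishes near 0 and near +oo, and the fundamental theorem of calculus
   gives a zero integral of F'. Exchanging derivative and expectation at a fixed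
   time avoids Fubini's theorem, hence the joint measurability of theta. *)

From HB Require Import structures.
Require Import Defs.
From mathcomp Require Import all_boot all_order all_algebra.
From mathcomp Require Import all_classical all_reals all_analysis.
From mathcomp Require Import measurable_realfun.

Set Implicit Arguments.
Unset Strict Implicit.
Unset Printing Implicit Defensive.

Import Order.TTheory GRing.Theory Num.Theory.
Import numFieldNormedType.Exports.

Local Open Scope classical_set_scope.
Local Open Scope ring_scope.

(** * Continuity and boundedness of the weak integrand *)

Lemma derive_pairl (R : realType) (V : normedModType R) (f : R * V -> R)
    (t v : R) (x : V) :
  'D_v (fun s : R => f (s, x)) t = 'D_(v, 0) f (t, x).
Proof.
rewrite /derive; congr (lim _); apply: (congr1 (fun g => g @ 0^')).
apply/funext => h /=.
have -> : h *: (v, 0 : V) + (t, x) = (h *: v + t, h *: 0 + x) by [].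
by rewrite scaler0 add0r.
Qed.

Lemma derive_pairr (R : realType) (V : normedModType R) (f : R * V -> R)
    (t : R) (x v : V) :
  'D_v (fun y : V => f (t, y)) x = 'D_(0, v) f (t, x).
Proof.
rewrite /derive; congr (lim _); apply: (congr1 (fun g => g @ 0^')).
apply/funext => h /=.
have -> : h *: (0 : R, v) + (t, x) = (h * 0 + t, h *: v + x) by [].
by rewrite mulr0 add0r.
Qed.

(** Partial derivatives become directional derivatives of [phi] on the product space, the form in
    which [C1_on] gives continuity jointly in time and space. *)
Lemma weak_integrandE (R : realType) (p : nat) (L : 'rV[R]_p -> R)
    (phi : R * 'rV[R]_p -> R) (z : R * 'rV[R]_p) :
  weak_integrand L phi z.1 z.2 =
  'D_(1, 0) phi z -
  \sum_(i < p) 'D_(0, delta_mx 0 i) phi z * 'D_(delta_mx 0 i) L z.2.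
Proof.
case: z => t x; rewrite /weak_integrand derive_pairl; congr (_ - _).
by apply: eq_bigr => i _; rewrite !mxE derive_pairr.
Qed.

(** Since [L] will be known to be C^1 only near [Omega], continuity of its derivatives is asked at
    the single point [z.2]. *)
Lemma continuous_weak_integrand (R : realType) (p : nat) (L : 'rV[R]_p -> R)
    (phi : R * 'rV[R]_p -> R) (z : R * 'rV[R]_p) :
  C1_on setT phi -> (forall v, {for z.2, continuous (fun x => 'D_v L x)}) ->
  {for z, continuous (fun z => weak_integrand L phi z.1 z.2)}.
Proof.
move=> phiC1 LC1; rewrite /prop_for /continuous_at.
under eq_fun do rewrite weak_integrandE.
rewrite weak_integrandE.
apply: cvgB; first exact: (phiC1 z I).2.
apply: cvg_big; first exact: add_continuous.
move=> i _; apply: cvgM; first exact: (phiC1 z I).2.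
exact: (continuous_comp cvg_snd (LC1 (delta_mx 0 i))).
Qed.

Lemma weak_integrand_bounded (R : realType) (p : nat) (L : 'rV[R]_p -> R)
    (phi : R * 'rV[R]_p -> R) (Omega : set 'rV[R]_p) (u v : R) :
  C1_on setT phi -> C1_near Omega L -> compact Omega ->
  exists2 M : R, 0 <= M & forall t x, t \in `[u, v] -> Omega x ->
    `|weak_integrand L phi t x| <= M.
Proof.
move=> phiC1 [U [_ OU LC1]] cO.
have cW : {within `[u, v] `*` Omega,
    continuous (fun z => weak_integrand L phi z.1 z.2)}.
  apply: continuous_in_subspaceT => z /set_mem[_ /OU Uz].
  by apply: continuous_weak_integrand => // w; exact: (LC1 _ Uz).2.
have /compact_bounded[M [_ MP]] :=
  continuous_compact cW (compact_setX (@segment_compact _ u v) cO).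
(* [compact_bounded] provides the constants strictly above [M]; [|M| + 1] is one of them and is
   nonnegative. *)
exists (`|M| + 1) => [|t x tuv Ox]; first by rewrite addr_ge0.
apply: (MP (`|M| + 1)); last by exists (t, x).
by rewrite ltr_pwDr// ler_norm.
Qed.

Lemma C1_on_continuous (R : realType) (V : normedModType R)
    (f : V -> R) : C1_on setT f -> continuous f.
Proof.
by move=> fC1 x; apply: differentiable_continuous; exact: (fC1 x I).1.
Qed.

(** * The chain rule along a gradient curve *)

Lemma linear_rV_sum (R : realType) (p : nat) (f : {linear 'rV[R]_p -> R})
    (v : 'rV[R]_p) : f v = \sum_(i < p) v 0 i * f (delta_mx 0 i).
Proof.
rewrite {1}(row_sum_delta v) linear_sum; apply: eq_bigr => i _.
by rewrite linearZ.
Qed.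

(** Serves to expand the differential of [phi] along the time axis and the space coordinates,
    matching the shape of [weak_integrandE]. *)
Lemma linear_prod_rV (R : realType) (p : nat)
    (f : {linear (R * 'rV[R]_p)%type -> R}) (a : R) (v : 'rV[R]_p) :
  f (a, v) = f (a, 0) + \sum_(i < p) v 0 i * f (0, delta_mx 0 i).
Proof.
pose g (w : 'rV[R]_p) := f (0, w).
have lin_g : linear g.
  move=> k w w'; rewrite /g -linearP; congr (f _).
  have -> : k *: ((0 : R), w) + (0, w') = (k * 0 + 0, k *: w + w') by [].
  by rewrite mulr0 addr0.
pose gM := GRing.isLinear.Build _ _ _ _ _ lin_g.
pose G : {linear 'rV[R]_p -> R} := HB.pack g gM.
rewrite -(linear_rV_sum G v) /= /g -linearD; congr (f _).
have -> : (a, 0 : 'rV[R]_p) + (0, v) = (a + 0, 0 + v) by [].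
by rewrite addr0 add0r.
Qed.

Lemma is_derive_gradient_flow (R : realType) (p : nat) (L : 'rV[R]_p -> R)
    (c : R -> 'rV[R]_p) (t : R) :
  gradient_flow L c -> 0 < t -> is_derive t (1 : R) c (- grad L (c t)).
Proof.
move=> flow t0.
(* The limit along the half-line becomes two-sided because [t > 0]: increments with [|h| <= t] keep
   [h + t] in [[0, +oo[]. *)
have ht : h + t @[h --> 0^'] --> within `[0, +oo[ t^'.
  move=> A; rewrite /within /= => -[/= e e0 eA].
  suff : \forall h \near 0^', A (h + t) by [].
  near=> h; apply: (eA (h + t)) => /=.
  - rewrite opprD addrCA subrr addr0 normrN.
    by near: h; exact: dnbhs0_lt.
  - by rewrite -subr_eq0 addrK; near: h; exact: nbhs_dnbhs_neq.
  - rewrite in_itv/= andbT -lerBlDr sub0r lerNl (le_trans (ler_norm _))//.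
    by rewrite normrN; near: h; exact: dnbhs0_le.
have cc : h^-1 *: (c (h *: 1 + t) - c t) @[h --> 0^'] --> - grad L (c t).
  have := cvg_comp _ _ ht (flow t (ltW t0)); apply: cvg_trans.
  apply: near_eq_cvg; apply: nearW => h /=.
  by rewrite addrK /GRing.scale /= mulr1.
apply: DeriveDef; first by apply/cvg_ex; exists (- grad L (c t)).
exact: cvg_lim cc.
Unshelve. all: by end_near. Qed.

Lemma is_derive_flow (R : realType) (p : nat) (L : 'rV[R]_p -> R)
    (phi : R * 'rV[R]_p -> R) (c : R -> 'rV[R]_p) (t : R) :
  C1_on setT phi -> gradient_flow L c -> 0 < t ->
  is_derive t (1 : R) (fun s => phi (s, c s)) (weak_integrand L phi t (c t)).
Proof.
move=> phiC1 /is_derive_gradient_flow /[apply] -[dc dcE].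
have dphi := (phiC1 (t, c t) I).1.
have {}dc : differentiable c t by apply/derivable1_diffP.
have dg : differentiable (fun s : R => (s, c s)) t.
  exact: differentiable_pair.
have dphig : differentiable (phi \o (fun s : R => (s, c s))) t.
  exact: differentiable_comp.
apply: DeriveDef; first exact: diff_derivable.
(* The space-time curve has velocity [(1, - grad L (c t))]; the differential of [phi] at this vector
   is the weak integrand. *)
have dg1 : 'd (fun s : R => (s, c s)) t 1 = (1, - grad L (c t)).
  by rewrite diff_pair//= -(deriveE _ dc) dcE diff_val.
rewrite (deriveE _ dphig) diff_comp//= dg1 linear_prod_rV.
rewrite (weak_integrandE L phi (t, c t)) deriveE//=; congr (_ + _).
rewrite -sumrN; apply: eq_bigr => i _.
rewrite !mxE -(deriveE _ dphi).
by rewrite mulNr mulrC.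
Qed.

(** * Measurability on compact sets and transport to the law *)

Lemma within_continuous_measurable_rV (R : realType) (n : nat)
    (D : set 'rV[R]_n) (g : 'rV[R]_n -> R) :
  measurable D -> {within D, continuous g} -> measurable_fun D g.
Proof.
move=> mD /continuousP cg.
(* Open intervals generate the Borel sets of [R], and their preimages are traces on [D] of open
   sets. *)
apply: (measurability _ (RGenOpens.measurableE R)).
move=> _ [_ [a [b ->] <-]].
have /open_subspaceP[V oV VD] :=
  cg _ (@interval_open _ (BRight a) (BLeft b) isT isT).
by rewrite setIC -VD; apply: measurableI => //; exact: open_rV_measurable.
Qed.

Lemma compact_measurable_rV (R : realType) (n : nat) (D : set 'rV[R]_n) :
  compact D -> measurable D.
Proof.
move=> /(compact_closed (@norm_hausdorff _ _)) cD.
rewrite -(setCK D); apply: measurableC; apply: open_rV_measurable.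
exact: closed_openC.
Qed.

Section law.
Variables (R : realType) (p : nat) (d : measure_display).
Variables (T : measurableType d) (P : probability T R).
Variables (D : set 'rV[R]_p) (X : {RV P >-> 'rV[R]_p}).
Hypothesis (XD : forall w, D (X w)).

(** Extending [g] by zero off [D] makes it measurable everywhere, and composition with [X] does not
    see the extension, as [X] takes values in [D]. *)
Lemma integral_distribution_on (g : 'rV[R]_p -> \bar R) :
  measurable D -> measurable_fun D g -> P.-integrable setT (g \o X) ->
  (\int[distribution P X]_(x in D) g x = \int[P]_w g (X w))%E.
Proof.
move=> mD mg ig.
have gX : (g \_ D) \o X = g \o X.
  by apply/funext => w /=; rewrite patchE mem_set.
rewrite integral_mkcond integral_distribution ?gX//.
by apply/(measurable_restrictT _ mD); exact: mg.
Qed.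

(** Continuity on a compact set gives a bound, and bounded measurable functions are integrable under
    a probability. *)
Lemma integrable_comp_compact (g : 'rV[R]_p -> R) :
  compact D -> {within D, continuous g} ->
  P.-integrable setT (EFin \o (g \o X)).
Proof.
move=> cD cg; apply: measurable_bounded_integrable => //.
- by rewrite [ltLHS]probability_setT ltry.
- have mg := within_continuous_measurable_rV (compact_measurable_rV cD) cg.
  apply: (measurable_comp (compact_measurable_rV cD) _ mg) => //.
  by move=> _ [w _ <-].
- have /compact_bounded[M [Mr MP]] := continuous_compact cg cD.
  by exists M; split => // x Mx w _; apply: (MP x Mx); exists (X w).
Qed.

End law.

(** * Differentiation of the mean under the expectation *)

Lemma continuous_pair_at (X Y Z : topologicalType) (f : X -> Y) (g : X -> Z)
    (x : X) :
  {for x, continuous f} -> {for x, continuous g} ->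
  {for x, continuous (fun y => (f y, g y))}.
Proof. by move=> cf cg; exact: (cvg_pair cf cg). Qed.

Section mean.
Variables (R : realType) (p : nat) (d : measure_display).
Variables (T : measurableType d) (P : probability T R).
Variables (Omega : set 'rV[R]_p) (L : 'rV[R]_p -> R).
Variable theta : R -> {RV P >-> 'rV[R]_p}.
Variable phi : R * 'rV[R]_p -> R.
Hypothesis cO : compact Omega.
Hypothesis LC1 : C1_near Omega L.
Hypothesis flow : forall w : T, gradient_flow L (fun t => theta t w).
Hypothesis thetaO : forall (w : T) (t : R), 0 <= t -> Omega (theta t w).
Hypothesis phiC1 : C1_on setT phi.

Let F (t : R) : R := \int[P]_w phi (t, theta t w).

Let F' (t : R) : R := \int[P]_w weak_integrand L phi t (theta t w).

Lemma weak_integrand_continuous_at (t : R) (x : 'rV[R]_p) :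
  Omega x -> {for (t, x), continuous (fun z => weak_integrand L phi z.1 z.2)}.
Proof.
have [U [_ OU UC1]] := LC1 => /OU Ux.
by apply: continuous_weak_integrand => // v; exact: (UC1 _ Ux).2.
Qed.

Lemma integrable_phi (t : R) : 0 <= t ->
  P.-integrable setT (EFin \o (fun w => phi (t, theta t w))).
Proof.
move=> t0; apply: (integrable_comp_compact (fun w => thetaO w t0)
  (g := fun x => phi (t, x))) => //.
apply: continuous_subspaceT => x.
apply: (@continuous_comp _ _ _ (fun x => (t, x)) phi).
  by apply: continuous_pair_at; [exact: cst_continuous|exact: cvg_id].
exact: C1_on_continuous.
Qed.

Lemma within_continuous_weak_integrand (t : R) :
  {within Omega, continuous (weak_integrand L phi t)}.
Proof.
apply: continuous_in_subspaceT => x /set_mem Ox.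
apply: (@continuous_comp _ _ _ (fun x => (t, x))
  (fun z => weak_integrand L phi z.1 z.2)).
  by apply: continuous_pair_at; [exact: cst_continuous|exact: cvg_id].
exact: weak_integrand_continuous_at.
Qed.

Lemma integrable_weak_integrand (t : R) : 0 <= t ->
  P.-integrable setT (EFin \o (fun w => weak_integrand L phi t (theta t w))).
Proof.
move=> t0; apply: (integrable_comp_compact (fun w => thetaO w t0)) => //.
exact: within_continuous_weak_integrand.
Qed.

Lemma integral_weak_integrand (t : R) : 0 <= t ->
  (\int[distribution P (theta t)]_(x in Omega) (weak_integrand L phi t x)%:E =
   (F' t)%:E)%E.
Proof.
move=> t0; have iw := integrable_weak_integrand t0.
have mO := compact_measurable_rV cO.
rewrite (integral_distribution_on (fun w => thetaO w t0))//.
  by rewrite /F' /Rintegral fineK//; exact: integrable_fin_num.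
apply/measurable_EFinP. apply: within_continuous_measurable_rV => //.
exact: within_continuous_weak_integrand.
Qed.

(** The window [](t / 2), (t + 1)[] is where domination takes place: it stays in the positive times,
    where the curves have two-sided derivatives. *)
Let itv_pos (t s : R) : 0 < t -> s \in `](t / 2), (t + 1)[ -> 0 < s.
Proof.
by move=> t0; rewrite in_itv/= => /andP[+ _]; apply: lt_trans; rewrite divr_gt0.
Qed.

Let in_itv_pos (t : R) : 0 < t -> t \in `](t / 2), (t + 1)[.
Proof.
by move=> t0; rewrite in_itv/= ltrDl ltr01 andbT gtr_pMr// invf_lt1// ltr1n.
Qed.

(** The time derivatives along all curves are dominated on the window around [t] by one constant
    [M], which is integrable because [P] is finite. *)
Lemma is_derive_mean (t : R) : 0 < t -> is_derive t (1 : R) F (F' t).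
Proof.
move=> t0.
have [M M0 MP] := weak_integrand_bounded (t / 2) (t + 1) phiC1 LC1 cO.
pose f s w := phi (s, theta s w).
have df (s : R) w : 0 < s ->
    is_derive s (1 : R) (f ^~ w) (weak_integrand L phi s (theta s w)).
  by move=> s0; exact: is_derive_flow.
have d1f (s : R) w : 0 < s ->
    partial1of2 f s w = weak_integrand L phi s (theta s w).
  by move=> s0; rewrite partial1of2E; have [_ ->] := df s w s0.
have intf (s : R) : `](t / 2), (t + 1)[%classic s ->
    P.-integrable setT (EFin \o f s).
  by move=> /(itv_pos t0)/ltW/integrable_phi.
have derf (s : R) w : `](t / 2), (t + 1)[%classic s -> setT w ->
    derivable (f ^~ w) s 1.
  by move=> /(itv_pos t0) s0 _; have [] := df s w s0.
have intM : P.-integrable setT (EFin \o cst M).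
  by apply: finite_measure_integrable_cst.
have fM (s : R) w : `](t / 2), (t + 1)[%classic s -> setT w ->
    `|partial1of2 f s w| <= M.
  move=> sI _; have s0 := itv_pos t0 sI; rewrite d1f//.
  by apply: MP; [exact: subset_itv_oo_cc|exact/thetaO/ltW].
apply: DeriveDef.
  exact: (derivable_under_integral measurableT (in_itv_pos t0) intf derf
    (fun=> M0) intM fM).
rewrite -derive1E (differentiation_under_integral measurableT (in_itv_pos t0)
  intf derf (fun=> M0) intM fM).
by apply: eq_Rintegral => w _; rewrite d1f.
Qed.

(** Dominated convergence again, with a constant bound; for fixed [w] the integrand is continuous in
    time since the curve itself is. *)
Lemma continuous_mean_derivative (t : R) : 0 < t -> {for t, continuous F'}.
Proof.
move=> t0.
have [M M0 MP] := weak_integrand_bounded (t / 2) (t + 1) phiC1 LC1 cO.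
apply: (@continuity_under_integral _ _ _ P
    (fun s w => weak_integrand L phi s (theta s w)) setT measurableT
    (t / 2) (t + 1) _ _ (cst M)).
- by move=> s /(itv_pos t0)/ltW/integrable_weak_integrand.
- apply: aeW => w _ s /set_mem/(itv_pos t0) s0.
  apply: (@continuous_comp _ _ _ (fun s => (s, theta s w))
    (fun z => weak_integrand L phi z.1 z.2)).
    apply: continuous_pair_at; first exact: cvg_id.
    have [dc _] := is_derive_gradient_flow (@flow w) s0.
    by apply: differentiable_continuous; exact/derivable1_diffP.
  by apply: weak_integrand_continuous_at; exact/thetaO/ltW.
- exact: finite_measure_integrable_cst.
- move=> s sI; apply: aeW => w _.
  by apply: MP; [exact: subset_itv_oo_cc|exact/thetaO/ltW/(itv_pos t0)].
- exact/mem_set/in_itv_pos.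
Qed.

End mean.

(** * Time support of a test function *)

Lemma test_function_time_support (R : realType) (p : nat)
    (phi : R * 'rV[R]_p -> R) : test_function phi ->
  exists a b : R, [/\ 0 < a, a < b &
    forall t x, t < a \/ b < t -> phi (t, x) = 0].
Proof.
move=> [_ csupp supp_pos].
(* The projection [K] of the support to the time axis is compact and misses [0], so it is bounded
   and keeps a positive distance from [0]. *)
pose K : set R := fst @` closure [set z | phi z != 0].
have cK : compact K.
  apply: continuous_compact csupp; apply: continuous_subspaceT => z.
  exact: cvg_fst.
have phi0 t x : ~ K t -> phi (t, x) = 0.
  move=> Kt; apply: contra_notP Kt => /eqP phitx.
  by exists (t, x) => //; exact: subset_closure.
have [M [_ MP]] := compact_bounded cK.
have oK : open (~` K).
  by apply: closed_openC; apply: compact_closed cK; exact: norm_hausdorff.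
have K0 : (~` K) 0 by move=> [z /supp_pos /= z0 z0E]; rewrite z0E ltxx in z0.
have /nbhs_ballP[e /= e0 eK] : nbhs (0 : R) (~` K) by exact: open_nbhs_nbhs.
(* [|M| + 1] already bounds [K] from above; the added [e] ensures that the upper time exceeds the
   lower one. *)
have e_b : e < `|M| + 1 + e by rewrite ltrDr ltr_wpDl.
exists e, (`|M| + 1 + e); split => // t x tab; apply: phi0 => Kt.
have t0 : 0 < t by case: Kt => z /supp_pos /= z0 <-.
case: tab => [te|bt].
  by apply: (eK t) => //; rewrite /ball /= sub0r normrN gtr0_norm.
have : t <= `|M| + 1.
  rewrite -[leLHS]gtr0_norm//; apply: MP Kt.
  by rewrite ltr_pwDr// ler_norm.
by apply/negP; rewrite -ltNge (le_lt_trans _ bt)// lerDl ltW.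
Qed.

(** * Integration of the derivative of the mean over time *)

Theorem theorem1 (R : realType) (p : nat)
    (d : measure_display) (T : measurableType d) (P : probability T R)
    (Omega : set 'rV[R]_p) (L : 'rV[R]_p -> R)
    (theta : R -> {RV P >-> 'rV[R]_p})
    (Omega_compact : compact Omega)
    (L_C1 : C1_near Omega L)
    (theta_flow : forall w : T, gradient_flow L (fun t => theta t w))
    (theta_in : forall (w : T) (t : R), 0 <= t -> Omega (theta t w))
    (law_pos : forall t : R, 0 <= t ->
       ae_positive_density Omega (distribution P (theta t))) :
  continuity_equation Omega L (fun t => distribution P (theta t)).
Proof.
move=> phi phi_test; have [phiC1 _ _] := phi_test.
have [a [b [a0 ab phi0]]] := test_function_time_support phi_test.
pose F (t : R) := (\int[P]_w phi (t, theta t w))%R.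
pose F' (t : R) := (\int[P]_w weak_integrand L phi t (theta t w))%R.
have dF (t : R) : 0 < t -> is_derive t (1 : R) F (F' t).
  exact: (is_derive_mean Omega_compact L_C1 theta_flow theta_in phiC1).
have cF' (t : R) : 0 < t -> {for t, continuous F'}.
  exact: (continuous_mean_derivative Omega_compact L_C1 theta_flow theta_in
    phiC1).
have F0 (t : R) : t < a \/ b < t -> F t = 0.
  move=> tab; rewrite /F (@eq_Rintegral _ _ _ _ _ (cst 0)) => [|w _].
    by rewrite Rintegral_cst// mul0r.
  exact: phi0.
have F'0 (t : R) : 0 < t -> t < a \/ b < t -> F' t = 0.
  move=> t0 tab; have [_ <-] := dF t t0.
  (* The strict inequalities are open conditions, so [F] vanishes on a whole neighbourhood of
     [t]. *)
  rewrite -(derive_cst 0 t 1); apply: near_eq_derive.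
  case: tab => [ta|bt].
    by near=> s; apply: F0; left; near: s; exact: lt_nbhsl.
  by near=> s; apply: F0; right; near: s; exact: lt_nbhsr.
(* The endpoints [a / 2] and [b + 1] lie strictly outside [[a, b]], so [F] vanishes there, and
   [a / 2 > 0] keeps the segment in the times where [F] is differentiable. *)
have a20 : 0 < a / 2 by rewrite divr_gt0.
have a2a : a / 2 < a by rewrite gtr_pMr// invf_lt1// ltr1n.
have bb1 : b < b + 1 by rewrite ltrDl.
have a2b1 : a / 2 < b + 1 by rewrite (lt_trans a2a)// (lt_trans ab).
have contF (t : R) : 0 < t -> {for t, continuous F}.
  move=> t0; apply: differentiable_continuous; apply/derivable1_diffP.
  by have [] := dF t t0.
transitivity
  (\int[lebesgue_measure]_(t in `[(a / 2)%R, (b + 1)%R]) (F' t)%:E)%E.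
  (* Both integrands are extended by zero and compared pointwise: at [t > 0] off the segment [F' t]
     is zero, and no [t <= 0] lies in the segment. *)
  rewrite integral_mkcond [RHS]integral_mkcond; congr integral.
  apply/funext => t; rewrite !patchE.
  case: ifPn => [/set_mem|/negP]; rewrite ?inE /= in_itv /= andbT => t0.
    rewrite (integral_weak_integrand Omega_compact L_C1 theta_in phiC1)//;
      last exact: ltW.
    case: ifPn => // /negP; rewrite inE /= in_itv /= => /negP.
    rewrite negb_and -!ltNge => tab; congr EFin; apply: F'0 => //.
    case/orP: tab => [ta|bt]; first by left; exact: lt_trans a2a.
    by right; exact: lt_trans bt.
  case: ifPn => //; rewrite inE /= in_itv /= => /andP[ta _].
  by exfalso; apply: t0; exact: lt_le_trans ta.
(* The integral equals [F (b + 1) - F (a / 2)], a difference of two zeros. *)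
rewrite (@continuous_FTC2 _ F' F) //.
- by rewrite !F0 ?subee//; [left|right].
- apply: continuous_in_subspaceT => t /set_mem /=.
  rewrite in_itv /= => /andP[ta _].
  by apply: cF'; exact: lt_le_trans ta.
- split.
  + move=> t; rewrite in_itv /= => /andP[ta _].
    by have [] := dF t (lt_trans a20 ta).
  + by apply: cvg_at_right_filter; exact: contF.
  + by apply: cvg_at_left_filter; apply: contF; exact: lt_trans a2b1.
- move=> t; rewrite in_itv /= => /andP[ta _].
  by rewrite derive1E; have [] := dF t (lt_trans a20 ta).
Unshelve. all: by end_near. Qed.
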